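(* Let $X$ be a Hausdorff topological space. Suppose that for every function $f: X \to \mathbb{R} \cup \{+\infty\}$ which is proper, lower semicontinuous and bounded from below, for every $x_0 \in \operatorname{dom} f$ and for every $\varepsilon>0$, there exists a continuous bounded function $h: X \to \mathbb{R}_+$ with $$h(x_0)=0, \qquad \|h\|_{\infty} < f(x_0)-\inf_{X}f+\varepsilon,$$ such that the function $f+h$ attains its strong minimum on $X$ at $x_0$. Then $X$ is a completely regular topological space that satisfies the first axiom of countability (i.e. every point of $X$ has a countable local base).
   Context: $\mathbb{R}_+$ denotes the set of nonnegative real numbers. For an extended real-valued function $f$ on $X$, $\operatorname{dom} f$ is the set of points of $X$ at which $f$ has a finite value, and $f$ is proper if $\operatorname{dom} f \neq \emptyset$. For a bounded function $h:X\to\mathbb{R}$, $\|h\|_\infty := \sup\{|h(x)| : x\in X\}$. A function $\varphi:X\to\mathbb{R}\cup\{+\infty\}$ attains its strong minimum on $X$ at $x_0$ if $x_0$ is the unique point at which $\varphi$ attains its minimum on $X$, and every sequence $\{x_n\}_n\subset X$ with $\varphi(x_n)\to\inf_X\varphi$ satisfies $x_n\to x_0$. A topological space $X$ is completely regular if it is Hausdorff and for every set $A\subset X$ and every point $x\in X\setminus\overline{A}$ there exists a continuous function $f:X\to\mathbb{R}$ such that $f(x)\notin\overline{f(A)}$ (equivalently, it is Hausdorff and for every closed set $A$ and every point $x\notin A$ there is a continuous function $f:X\to[0,1]$ with $f(x)=0$ and $f\equiv 1$ on $A$). *)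

(* Defs.v *)
From mathcomp Require Import all_boot all_order all_algebra.
From mathcomp Require Import all_classical all_reals all_analysis.

Set Implicit Arguments.
Unset Strict Implicit.
Unset Printing Implicit Defensive.

Import Order.TTheory GRing.Theory Num.Theory.
Import numFieldNormedType.Exports.

Local Open Scope classical_set_scope.
Local Open Scope ring_scope.

Definition edom (R : realType) (X : Type) (f : X -> \bar R) : set X :=
  [set x | f x \is a fin_num].

Definition proper_fun (R : realType) (X : Type) (f : X -> \bar R) : Prop :=
  edom f !=set0.

Definition bounded_below (R : realType) (X : Type) (f : X -> \bar R) : Prop :=
  exists m : R, forall x, (m%:E <= f x)%E.

(* [sup] is only meaningful on nonempty bounded sets of reals: to be used with
   [h] bounded and [X] inhabited. *)
Definition sup_norm (R : realType) (X : Type) (h : X -> R) : R :=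
  sup (range (fun x => `|h x|)).

Definition attains_min (R : realType) (X : Type) (phi : X -> \bar R) (x0 : X)
    : Prop :=
  forall x, (phi x0 <= phi x)%E.

Definition attains_strong_min (R : realType) (X : topologicalType)
    (phi : X -> \bar R) (x0 : X) : Prop :=
  [/\ attains_min phi x0,
      forall x, attains_min phi x -> x = x0 &
      forall u : nat -> X,
        phi (u n) @[n --> \oo] --> ereal_inf (range phi) ->
        u n @[n --> \oo] --> x0].

(* The library's [completely_regular_space] is stated through uniform
   structures and does not include the Hausdorff property; this is the
   definition by real-valued functions. *)
Definition completely_regular (R : realType) (X : topologicalType) : Prop :=
  hausdorff_space X /\
  forall (A : set X) (x : X), ~ closure A x ->
    exists f : X -> R, continuous f /\ ~ closure (f @` A) (f x).

Definition first_countable (X : topologicalType) : Prop :=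
  forall x : X, exists B : set (set X),
    [/\ countable B,
        forall U, B U -> open_nbhs x U &
        forall V, nbhs x V -> exists2 U, B U & U `<=` V].

(* Main.v *)
Require Import Defs.
From mathcomp Require Import all_boot all_order all_algebra.
From mathcomp Require Import all_classical all_reals all_analysis.

Import Order.TTheory GRing.Theory Num.Theory.
Import numFieldNormedType.Exports.

Local Open Scope classical_set_scope.
Local Open Scope ring_scope.

(** The hypothesis is applied to the zero function only.  At each point [x0] it
    yields a continuous [h >= 0] with [h x0 = 0] whose strong minimum is at
    [x0].  Strength of the minimum says that the sublevel sets
    [h < 1 / (n + 1)], which are open by continuity, shrink to [x0], i.e. they
    form a local base at [x0] ([strong_min_sublevel]).  This single [h] gives
    both conclusions: the local base is countable, and if [x0] is outside the
    closure of [A] then some sublevel set misses [A], so that [h] is bounded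
    away from [h x0 = 0] on [A]. *)

(** Otherwise each sublevel set contains a point outside [V]; these points form
    a minimizing sequence, which must converge to [x0] while avoiding [V]. *)
Lemma strong_min_sublevel (R : realType) (X : topologicalType) (h : X -> R)
    (x0 : X) (V : set X) :
  attains_strong_min (EFin \o h) x0 -> nbhs x0 V ->
  exists n : nat, [set x | h x < h x0 + n.+1%:R^-1] `<=` V.
Proof.
move=> [hmin _ hseq] Vx0; apply: contrapT => noV.
have /choice[u uP] : forall n : nat,
    exists x, h x < h x0 + n.+1%:R^-1 /\ ~ V x.
  move=> n; apply: contrapT => nox; apply: noV; exists n => x hx.
  by apply: contrapT => nVx; apply: nox; exists x.
have infE : ereal_inf (range (EFin \o h)) = (h x0)%:E.
  apply/eqP; rewrite eq_le; apply/andP; split.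
    by apply: ereal_inf_lbound; exists x0.
  by apply: le_ereal_inf_tmp => _ [x _ <-]; exact: hmin.
have hu : h (u n) @[n --> \oo] --> h x0.
  apply: (@squeeze_cvgr _ _ _ _ (fun=> h x0)
            (fun n => h x0 + n.+1%:R^-1)).
  - apply: nearW => n; rewrite (ltW (uP n).1) andbT.
    by have := hmin (u n); rewrite lee_fin.
  - exact: cvg_cst.
  - rewrite -[X in _ --> X]addr0; apply: cvgD; first exact: cvg_cst.
    exact: cvg_harmonic.
have /hseq /(_ V Vx0)[N _ /(_ N (leqnn N))] :
    (EFin \o h) (u n) @[n --> \oo] --> ereal_inf (range (EFin \o h)).
  by rewrite infE; apply: cvg_EFin hu; exact: nearW.
exact: (uP N).2.
Qed.

Lemma open_sublevel (R : realType) (X : topologicalType) (h : X -> R) (r : R) :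
  continuous h -> open [set x | h x < r].
Proof.
move=> hc; have op := @open_comp _ _ h [set s : R | s < r].
by apply: op => [x _|]; [exact: hc | exact: open_lt].
Qed.

Theorem theorem2p5 (R : realType) (X : topologicalType)
  (hausX : hausdorff_space X)
  (perturb : forall f : X -> \bar R,
    (forall x, f x != -oo%E) ->
    proper_fun f -> lower_semicontinuous f -> bounded_below f ->
    forall (x0 : X) (eps : R), edom f x0 -> 0 < eps ->
    exists h : X -> R,
      [/\ continuous h, bounded_fun h & forall x, 0 <= h x] /\
      [/\ h x0 = 0,
          ((sup_norm h)%:E < f x0 - ereal_inf (range f) + eps%:E)%E &
          attains_strong_min (fun x => f x + (h x)%:E)%E x0]) :
  completely_regular R X /\ first_countable X.
Proof.
have base x0 : exists h : X -> R, [/\ continuous h, h x0 = 0 &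
    forall V, nbhs x0 V -> exists n : nat, [set x | h x < n.+1%:R^-1] `<=` V].
  have [||||//|h [[hc _ _] [hx0 _ hmin]]] :=
      perturb (cst 0%E) _ _ _ _ x0 1 _ ltr01.
  - by [].
  - by exists x0.
  - move=> x a a0; exists setT; first exact: filterT.
    by move=> y _.
  - by exists 0 => x.
  - exists h; split=> // V Vx0.
    have phiE : (fun x => cst 0 x + (h x)%:E)%E = EFin \o h.
      by apply/funext => x /=; rewrite add0e.
    rewrite phiE in hmin.
    have [n nV] := strong_min_sublevel _ _ _ _ _ hmin Vx0.
    by exists n; rewrite hx0 add0r in nV.
split; first split=> // A x Ax.
- have [h [hc hx hV]] := base x; exists h; split=> //.
  have [n nA] : exists n : nat, [set y | h y < n.+1%:R^-1] `<=` ~` A.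
    apply: hV; apply: contrapT => nAx; apply: Ax => B Bx.
    apply: contrapT => AB; apply: nAx; apply: filterS Bx => y By Ay.
    by apply: AB; exists y.
  have hx_lt : nbhs (h x) [set r : R | r < n.+1%:R^-1].
    by apply: open_nbhs_nbhs; split; [exact: open_lt | rewrite /= hx].
  by move=> /(_ _ hx_lt)[_ [[y Ay <-] /nA]].
- move=> x; have [h [hc hx hV]] := base x.
  exists (range (fun n : nat => [set y | h y < n.+1%:R^-1])); split.
  + exact: card_image_le.
  + move=> _ [n _ <-]; split; first exact: open_sublevel.
    by rewrite /= hx.
  + by move=> V /hV[n nV]; exists [set y | h y < n.+1%:R^-1] => //; exists n.
Qed.
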